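(* Let $\mathcal{H}$ be a finite dimensional real or complex inner product space, let $A:\mathcal{H}\to\mathcal{H}$ be a linear Hermitian operator, and let $\mathcal{X}$ and $\mathcal{Y}$ be subspaces of $\mathcal{H}$ with $\dim\mathcal{X}=\dim\mathcal{Y}$. Let $\lambda_{\min(\mathcal{X}+\mathcal{Y})}$ and $\lambda_{\max(\mathcal{X}+\mathcal{Y})}$ be the smallest and largest eigenvalues, respectively, of the operator $(P_{\mathcal{X}+\mathcal{Y}}A)|_{\mathcal{X}+\mathcal{Y}}$. Then $$\left|\Lambda\left((P_{\mathcal{X}}A)|_{\mathcal{X}}\right)-\Lambda\left((P_{\mathcal{Y}}A)|_{\mathcal{Y}}\right)\right|\prec_w\left(\lambda_{\max(\mathcal{X}+\mathcal{Y})}-\lambda_{\min(\mathcal{X}+\mathcal{Y})}\right)\sin\Theta(\mathcal{X},\mathcal{Y}).$$ If, in addition, one of the subspaces $\mathcal{X}$, $\mathcal{Y}$ is $A$-invariant, then $$\left|\Lambda\left((P_{\mathcal{X}}A)|_{\mathcal{X}}\right)-\Lambda\left((P_{\mathcal{Y}}A)|_{\mathcal{Y}}\right)\right|\prec_w\left(\lambda_{\max(\mathcal{X}+\mathcal{Y})}-\lambda_{\min(\mathcal{X}+\mathcal{Y})}\right)\sin^2\Theta(\mathcal{X},\mathcal{Y}).$$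
   Context: For a subspace $\mathcal{Z}$, $P_{\mathcal{Z}}$ is the orthogonal projector onto $\mathcal{Z}$, and $(P_{\mathcal{Z}}A)|_{\mathcal{Z}}$ is the restriction of $P_{\mathcal{Z}}A$ to $\mathcal{Z}$, a Hermitian operator on $\mathcal{Z}$. $\Lambda(\cdot)$ is the vector of eigenvalues of a Hermitian operator, repeated according to multiplicity and arranged in decreasing (i.e. nonincreasing) order. Principal angles: for $\dim\mathcal{X}\le\dim\mathcal{Y}$, the vector $\Theta(\mathcal{X},\mathcal{Y})$ of $\dim\mathcal{X}$ angles from $\mathcal{X}$ to $\mathcal{Y}$ has components in $[0,\pi/2]$ arranged in decreasing order, and the components of $\cos^2\Theta(\mathcal{X},\mathcal{Y})$ are the eigenvalues of $(P_{\mathcal{X}}P_{\mathcal{Y}})|_{\mathcal{X}}$ arranged in increasing order. Functions of vectors (absolute value, $\sin$, $\sin^2$) are taken component-wise. For a real vector $x$, $x^\downarrow$ denotes its rearrangement in decreasing order. For real $n$-vectors, $x\prec_w y$ (weak majorization) means $\sum_{i=1}^k x_i^\downarrow\le\sum_{i=1}^k y_i^\downarrow$ for $k=1,\ldots,n$. *)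

(* Defs.v *)
From HB Require Import structures.
From mathcomp Require Import all_boot all_order all_algebra.
From mathcomp Require Import sesquilinear complex.
From mathcomp Require Import boolp classical_sets reals trigo.

Set Implicit Arguments.
Unset Strict Implicit.
Unset Printing Implicit Defensive.

Import Order.TTheory GRing.Theory Num.Theory.

Local Open Scope ring_scope.

(* The scalar field of an inner product space is R or R[i], for R : realType;
   the [scalar_kind] tells which, so that both cases share one development. *)
Variant scalar_kind := RealScalars | ComplexScalars.

Definition scalars (R : realType) (k : scalar_kind) : numFieldType :=
  match k with
  | RealScalars => R : numFieldType
  | ComplexScalars => R[i] : numFieldType
  end.

Definition scalar_conj (R : realType) (k : scalar_kind) :
    {rmorphism scalars R k -> scalars R k} :=
  match k return {rmorphism scalars R k -> scalars R k} with
  | RealScalars => (idfun : {rmorphism R -> R})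
  | ComplexScalars => (Num.conj : {rmorphism R[i] -> R[i]})
  end.

Definition of_real (R : realType) (k : scalar_kind) : R -> scalars R k :=
  match k return R -> scalars R k with
  | RealScalars => fun x => x
  | ComplexScalars => fun x => (x%:C)%C
  end.

Section Operators.
Variables (R : realType) (k : scalar_kind).
Local Notation K := (scalars R k).

(* Multiplicities are those of the roots of the characteristic polynomial. *)
Definition is_eigenvalue_vector (V : vectType K) (f : 'End(V)) (s : seq R) :=
  sorted >=%R s /\
  char_poly (passmx.mxof (vbasis {:V}) (vbasis {:V}) f)
    = \prod_(a <- s) ('X - (of_real k a)%:P).

(* There is at most one such s; [::] is a junk value for the operators whose
   characteristic polynomial does not split over the real numbers, which does
   not happen for Hermitian ones. *)
Definition Lambda (V : vectType K) (f : 'End(V)) : seq R :=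
  xget [::] [set s | is_eigenvalue_vector f s]%classic.

(* On the zero space, which has no eigenvalues, both of these are 0. *)
Definition lambda_max (V : vectType K) (f : 'End(V)) : R := head 0 (Lambda f).
Definition lambda_min (V : vectType K) (f : 'End(V)) : R := last 0 (Lambda f).

(* [vsproj Z] only retypes f z as an element of Z when f maps Z into Z: outside
   Z it is a projection that has nothing to do with the inner product. *)
Definition restriction (V : vectType K) (Z : {vspace V}) (f : 'End(V)) :
    'End(subvs_of Z) :=
  (linfun (vsproj Z) \o f \o linfun (vsval : subvs_of Z -> V))%VF.

Variables (V : vectType K) (dot : {dot V for scalar_conj R k}).

Definition hermitian_op (f : 'End(V)) := forall u v, dot (f u) v = dot u (f v).

Definition orthoproj (Z : {vspace V}) : 'End(V) := daddv_pi Z (orthov dot Z).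

(* (P_Z A)|_Z *)
Definition compression (Z : {vspace V}) (A : 'End(V)) : 'End(subvs_of Z) :=
  restriction Z (orthoproj Z \o A)%VF.

Definition is_principal_angles (X Y : {vspace V}) (t : seq R) :=
  [/\ sorted >=%R t,
      {in t, forall x, 0 <= x <= pi / 2} &
      [seq cos x ^+ 2 | x <- t] = rev (Lambda (compression X (orthoproj Y)))].

(* Theta X Y is only meant for \dim X <= \dim Y *)
Definition Theta (X Y : {vspace V}) : seq R :=
  xget [::] [set t | is_principal_angles X Y t]%classic.

Definition invariant_under (A : 'End(V)) (Z : {vspace V}) := (A @: Z <= Z)%VS.

End Operators.

Definition abs_diff (R : realType) (x y : seq R) : seq R :=
  [seq `|p.1 - p.2| | p <- zip x y].

Definition weakly_majorized (R : realType) (x y : seq R) :=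
  size x = size y /\
  forall k, (1 <= k <= size x)%N ->
    \sum_(a <- take k (sort >=%R x)) a <= \sum_(a <- take k (sort >=%R y)) a.

Notation "x '≺w' y" := (weakly_majorized x y)
  (at level 70, no associativity) : ring_scope.

(* Main.v *)
Require Import Defs.
From mathcomp Require Import all_boot all_order all_algebra.
From mathcomp Require Import sesquilinear complex.
From mathcomp Require Import reals trigo.
From mathcomp Require Import spectral fingroup perm boolp classical_sets.

(* The target is the inequality
     sum_i max(|lambda_i - mu_i| - delta tau, 0)
       <= delta sum_i max(sigma_i - tau, 0)   for every tau >= 0,
   with delta the spread of A on X + Y and sigma_i = sin theta_i (resp.
   sin^2 theta_i); taking for tau the k-th largest sigma_i gives the k-th partial
   sum inequality of the weak majorization. All of it happens inside X + Y, where
   l <= A <= u, u - l = delta.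
   The eigenvalues of P_X - P_Y are +-sin theta_i and zeros, so its part above
   tau, F = (P_X - P_Y - tau)_+, has trace sum_i max(sin theta_i - tau, 0), and
   P_X <= P_Y + F + tau. Conjugating by B = (A - l)^(1/2),
     B P_X B <= B (P_Y + F) B + tau delta,
   where B P_X B and B P_Y B have the eigenvalues lambda_i - l and mu_i - l, up to
   zeros. By monotonicity of eigenvalues the positive parts of
   lambda_i - mu_i - delta tau are at most the increments of the eigenvalues when
   B F B is added to B P_Y B, hence their sum is at most tr(F (A - l)). The same
   argument for -A bounds the opposite differences by tr(F (u - A)), and the two
   traces add up to delta tr F.
   When X is A-invariant, Y^* A Y - l dominates K^* (M - l) K, where M is the
   compression to X and K = P_X restricted to Y, and K K^* = 1 - G with G having
   the eigenvalues sin^2 theta_i: the argument is repeated on X with 1 and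
   K K^* in place of P_X and P_Y. *)

Set Implicit Arguments.
Unset Strict Implicit.
Unset Printing Implicit Defensive.

Import Order.TTheory GRing.Theory Num.Theory.

Local Open Scope ring_scope.

(** * Characteristic polynomials of products and blocks, and sums of positive parts *)

(* Up to a triangular factor, both sides are det [block_mx 'X%:M A B 1%:M]. *)
Lemma char_poly_mulmxC (F : comNzRingType) m n (A : 'M[F]_(m, n))
    (B : 'M[F]_(n, m)) :
  'X^n * char_poly (A *m B) = 'X^m * char_poly (B *m A).
Proof.
pose a := map_mx polyC A; pose b := map_mx polyC B.
pose M := block_mx ('X%:M : 'M_m) a b (1%:M : 'M_n).
have detM : \det M = char_poly (A *m B).
  have := det_mulmx M (block_mx 1%:M 0 (- b) 1%:M).
  rewrite det_lblock !det1 !mulr1 => <-.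
  rewrite mulmx_block !mulmx1 !mulmx0 mul1mx !add0r addrN det_ublock det1 mulr1.
  by rewrite /char_poly /char_poly_mx map_mxM mulmxN.
have := det_mulmx (block_mx 1%:M 0 (- b) 'X%:M) M.
rewrite det_lblock det1 mul1r det_scalar detM => <-.
rewrite mulmx_block !mul1mx !mul0mx !addr0 mulmx1.
rewrite mul_mx_scalar mul_scalar_mx scalerN addNr det_ublock det_scalar.
by rewrite /char_poly /char_poly_mx map_mxM mulNmx addrC.
Qed.

Lemma char_poly_conj (F : fieldType) n (M S T : 'M[F]_n) :
  T *m S = 1%:M -> char_poly (S *m M *m T) = char_poly M.
Proof.
move=> TS; have := char_poly_mulmxC (S *m M) T.
move=> /(mulfI (monic_neq0 (monicXn _ _))) ->.
by rewrite mulmxA TS mul1mx.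
Qed.

(** Each retained entry is at most c plus its excess over c, and the excesses of the other entries
    are nonnegative; no order on z enters. *)
Lemma sum_take_le_pos (F : realDomainType) (z : seq F) k (c : F) :
  (k <= size z)%N ->
  \sum_(a <- take k z) a <= c *+ k + \sum_(a <- z) Num.max (a - c) 0.
Proof.
move=> kz; rewrite -[X in _ <= _ + \sum_(a <- X) _](cat_take_drop k) big_cat /=.
rewrite addrA ler_wpDr //.
  by apply: sumr_ge0 => a _; rewrite le_max lexx orbT.
have {2}<- : size (take k z) = k by rewrite size_takel.
elim: (take k z) => [|a s IH] /=; first by rewrite !big_nil mulr0n addr0.
rewrite !big_cons mulrS addrACA; apply: lerD IH.
by rewrite -lerBlDl le_max lexx.
Qed.

Lemma nonincr_head (F : realDomainType) (s : seq F) i :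
  sorted >=%R s -> (i < size s)%N -> s`_i <= head 0 s.
Proof.
move=> ss si; rewrite -nth0; apply: (sorted_leq_nth ge_trans ge_refl) => //.
by rewrite inE (leq_ltn_trans _ si).
Qed.

(** For a projector P commuting with A, compressing A to the complement removes the block T. With A
    = 1 this is the idempotence of 1 - P. *)
Lemma compl_conj_mx (F : pzRingType) n (P A T : 'M[F]_n) :
  P *m A = T -> A *m P = T -> T *m P = T ->
  (1%:M - P) *m A *m (1%:M - P) = A - T.
Proof.
by move=> PA AP TP; rewrite mulmxBl mul1mx PA mulmxBr mulmx1 mulmxBl AP TP subrr subr0.
Qed.

(** Together with the next lemma, the equality case of [sum_take_le_pos]: retained entries above the
    threshold, dropped ones below it. *)
Lemma sum_pos_part_ge0 (F : realDomainType) (s : seq F) (c : F) :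
  all (>= c) s ->
  c *+ size s + \sum_(a <- s) Num.max (a - c) 0 = \sum_(a <- s) a.
Proof.
elim: s => [|a s IH] /=; first by rewrite !big_nil mulr0n addr0.
case/andP => ca /IH sE; rewrite !big_cons mulrS addrACA sE.
congr (_ + _); rewrite (max_idPl _) ?subr_ge0 //.
by rewrite addrC subrK.
Qed.

Lemma sum_pos_part_le0 (F : realDomainType) (s : seq F) (c : F) :
  all (<= c) s -> \sum_(a <- s) Num.max (a - c) 0 = 0.
Proof.
move=> /allP sc; rewrite big1_seq // => a /= /sc ac.
by apply/max_idPr; rewrite subr_le0.
Qed.

Lemma char_poly_comp (F : comNzRingType) n (M : 'M[F]_n) (q : {poly F}) :
  char_poly M \Po q = \det (q%:M - map_mx polyC M).
Proof.
rewrite /char_poly -det_map_mx; congr (\det _).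
apply/matrixP => i j; rewrite !mxE raddfB /= comp_polyC; congr (_ - _).
by case: eqP => _; rewrite ?mulr1n ?mulr0n ?comp_polyX ?comp_poly0.
Qed.

(** Clearing the lower left corner costs a factor (X + 1)^m on both sides and leaves (X - 1)(X + 1)
    + K L = X^2 - (1 - K L). *)
Lemma char_poly_block (F : idomainType) m (K L : 'M[F]_m) :
  char_poly (block_mx 1%:M K (- L) (- 1%:M)) = char_poly (1%:M - K *m L) \Po 'X^2.
Proof.
rewrite char_poly_comp /char_poly /char_poly_mx map_block_mx.
have -> : ('X%:M : 'M_(m + m)) = block_mx ('X%:M : 'M[{poly F}]_m) 0 0 'X%:M.
  by rewrite -scalar_mx_block.
rewrite opp_block_mx add_block_mx !add0r !map_mxB !map_mxN map_mx1 map_mxM !opprK.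
set k := map_mx polyC K; set l := map_mx polyC L.
pose p := 'X + 1 : {poly F}.
have pE : 'X%:M + 1%:M = p%:M :> 'M[{poly F}]_m by rewrite /p raddfD.
have qE : 'X%:M - 1%:M = ('X - 1)%:M :> 'M[{poly F}]_m by rewrite raddfB.
have p0 : p ^+ m != 0.
  by rewrite expf_neq0 // /p -(opprK 1) -polyCN monic_neq0 ?monicXsubC.
rewrite pE qE.
have := det_mulmx (block_mx ('X - 1)%:M (- k) l p%:M) (block_mx p%:M 0 (- l) 1%:M).
rewrite det_lblock det1 mulr1 det_scalar mulmx_block.
rewrite !mulmx0 !add0r !mulmx1 mulmxN mulNmx opprK.
rewrite (mul_mx_scalar p l) (mulmxN p%:M l) (mul_scalar_mx p l) subrr.
rewrite det_ublock det_scalar.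
move/(mulIf p0) => <-; congr (\det _).
rewrite -scalar_mxM opprB addrA addrAC; congr (_ + _).
have -> : ('X - 1) * p = 'X^2 - 1 by rewrite -subr_sqr expr1n.
by rewrite raddfB.
Qed.

Lemma char_poly_one_sub (F : comNzRingType) n (M : 'M[F]_n) :
  char_poly (1%:M - M) = (-1) ^+ n * (char_poly M \Po (1 - 'X)).
Proof.
rewrite char_poly_comp -detZ scaleN1r opprB raddfB /=.
by rewrite /char_poly /char_poly_mx map_mxB map_mx1 !opprB addrCA.
Qed.

(** For K = X Y^* and its adjoint: the sines are the same whichever subspace they are measured
    from. *)
Lemma char_poly_one_sub_mulmxC (F : idomainType) n (A B : 'M[F]_n) :
  char_poly (1%:M - A *m B) = char_poly (1%:M - B *m A).
Proof.
rewrite !char_poly_one_sub; congr (_ * (_ \Po _)).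
by apply: (mulfI (monic_neq0 (monicXn F n))); exact: char_poly_mulmxC.
Qed.

(** * Adjoints and positive semidefinite complex matrices *)

Section HermitianMatrices.
Variable R : rcfType.
Local Notation C := R[i].
Local Notation "x %:C" := (real_complex R x) (format "x %:C") : ring_scope.
Local Open Scope sesquilinear_scope.

Lemma adjmxK m n (A : 'M[C]_(m, n)) : A^t*^t* = A.
Proof. by apply/matrixP => i j; rewrite !mxE conjCK. Qed.

Lemma adjmxM m n p (A : 'M[C]_(m, n)) (B : 'M[C]_(n, p)) :
  (A *m B)^t* = B^t* *m A^t*.
Proof. by rewrite trmx_mul map_mxM. Qed.

Lemma adjmxD m n (A B : 'M[C]_(m, n)) : (A + B)^t* = A^t* + B^t*.
Proof. by rewrite linearD map_mxD. Qed.

Lemma adjmxN m n (A : 'M[C]_(m, n)) : (- A)^t* = - A^t*.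
Proof. by rewrite linearN map_mxN. Qed.

Lemma conj_real (x : R) : (x%:C)^* = x%:C :> C.
Proof. by apply/eqP; rewrite eq_complex /= oppr0 !eqxx. Qed.

Lemma adjmx_scalar n (a : R) : ((a%:C)%:M : 'M[C]_n)^t* = (a%:C)%:M.
Proof. by rewrite tr_scalar_mx map_scalar_mx; congr (_%:M); apply: conj_real. Qed.

Lemma real_complexM (x y : R) : (x * y)%:C = x%:C * y%:C :> C.
Proof. exact: rmorphM. Qed.

Lemma real_complexD (x y : R) : (x + y)%:C = x%:C + y%:C :> C.
Proof. exact: rmorphD. Qed.

Lemma real_complexB (x y : R) : (x - y)%:C = x%:C - y%:C :> C.
Proof. exact: rmorphB. Qed.

Lemma real_complexN (x : R) : (- x)%:C = - x%:C :> C.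
Proof. exact: rmorphN. Qed.

(** Vectors are rows; the order of [R[i]] makes the value of the form real as well as
    nonnegative. *)
Definition psd n (M : 'M[C]_n) := forall v : 'rV_n, 0 <= (v *m M *m v^t*) 0 0.

Lemma psdD n (M N : 'M[C]_n) : psd M -> psd N -> psd (M + N).
Proof.
by move=> hM hN v; rewrite mulmxDr mulmxDl mxE addr_ge0 ?hM ?hN.
Qed.

Lemma psdZ n (a : R) (M : 'M[C]_n) : 0 <= a -> psd M -> psd (a%:C *: M).
Proof.
move=> a0 hM v; rewrite -scalemxAr -scalemxAl mxE mulr_ge0 ?hM //.
by rewrite (lecR 0).
Qed.

Lemma psd_congr m n (B : 'M[C]_(m, n)) (M : 'M[C]_n) :
  psd M -> psd (B *m M *m B^t*).
Proof. by move=> hM v; move: (hM (v *m B)); rewrite adjmxM !mulmxA. Qed.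

Lemma row_dotE n (w : 'rV[C]_n) : (w *m w^t*) 0 0 = \sum_k `|w 0 k| ^+ 2.
Proof.
by rewrite mxE; apply: eq_bigr => k _; rewrite !mxE normCK.
Qed.

Lemma psd1 n : psd (1%:M : 'M[C]_n).
Proof.
by move=> v; rewrite mulmx1 row_dotE sumr_ge0 // => k _; rewrite exprn_ge0.
Qed.

Lemma psd_gram m n (B : 'M[C]_(m, n)) : psd (B *m B^t*).
Proof. by have := psd_congr B (@psd1 n); rewrite mulmx1. Qed.

(* The Hermitian matrix with eigenvalues f and the rows of U as eigenvectors. *)
Definition udiag n (U : 'M[C]_n) (f : 'I_n -> R) : 'M[C]_n :=
  U^t* *m diag_mx (\row_i (f i)%:C) *m U.

(** * Functional calculus in a fixed unitary eigenbasis *)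

Section Udiag.
Variables (n : nat) (U : 'M[C]_n).
Hypothesis unitU : U \is unitarymx.
Implicit Types f g : 'I_n -> R.

Lemma unitary_mulr : U *m U^t* = 1%:M.
Proof. exact/unitarymxP. Qed.

Lemma unitary_mull : U^t* *m U = 1%:M.
Proof. by apply: mulmx1C; exact: unitary_mulr. Qed.

Lemma udiagE f i j : udiag U f i j = \sum_k (U k i)^* * (f k)%:C * U k j.
Proof.
rewrite /udiag -mulmxA mul_diag_mx mxE; apply: eq_bigr => k _.
by rewrite !mxE mulrA.
Qed.

Lemma udiag_adj f : (udiag U f)^t* = udiag U f.
Proof.
rewrite /udiag !adjmxM adjmxK mulmxA tr_diag_mx map_diag_mx.
by apply: (congr1 (fun d => U^t* *m diag_mx d *m U));
  apply/rowP => k; rewrite !mxE; apply: conj_real.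
Qed.

Lemma udiagM f g : udiag U f *m udiag U g = udiag U (fun i => f i * g i).
Proof.
rewrite /udiag -!mulmxA (mulmxA U) unitary_mulr mul1mx (mulmxA (diag_mx _)).
rewrite mulmx_diag.
by apply: (congr1 (fun d => U^t* *m (diag_mx d *m U)));
  apply/rowP => k; rewrite !mxE -real_complexM.
Qed.

Lemma udiagB f g : udiag U f - udiag U g = udiag U (fun i => f i - g i).
Proof.
rewrite /udiag -mulmxBl -mulmxBr -raddfB /=.
by apply: (congr1 (fun d => U^t* *m diag_mx d *m U));
  apply/rowP => k; rewrite !mxE -real_complexB.
Qed.

Lemma udiagD f g : udiag U f + udiag U g = udiag U (fun i => f i + g i).
Proof.
rewrite /udiag -mulmxDl -mulmxDr -raddfD /=.
by apply: (congr1 (fun d => U^t* *m diag_mx d *m U));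
  apply/rowP => k; rewrite !mxE -real_complexD.
Qed.

Lemma udiagZ (e : R) f : e%:C *: udiag U f = udiag U (fun i => e * f i).
Proof.
rewrite /udiag scalemxAl scalemxAr -linearZ.
by apply: (congr1 (fun d => U^t* *m diag_mx d *m U));
  apply/rowP => k; rewrite !mxE -real_complexM.
Qed.

Lemma udiag_cst (c : R) : (c%:C)%:M = udiag U (fun=> c).
Proof.
rewrite /udiag; have -> : \row_(i < n) c%:C = const_mx c%:C.
  by apply/rowP => k; rewrite !mxE.
by rewrite diag_const_mx mul_mx_scalar -scalemxAl unitary_mull scalemx1.
Qed.

Lemma udiag_tr f : \tr (udiag U f) = (\sum_k f k)%:C.
Proof.
rewrite /udiag mxtrace_mulC mulmxA unitary_mulr mul1mx mxtrace_diag rmorph_sum.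
by apply: eq_bigr => k _; rewrite mxE.
Qed.

Lemma udiag_form f (v : 'rV[C]_n) :
  (v *m udiag U f *m v^t*) 0 0 = \sum_k (f k)%:C * `|(v *m U^t*) 0 k| ^+ 2.
Proof.
have -> : v *m udiag U f *m v^t* =
    v *m U^t* *m diag_mx (\row_i (f i)%:C) *m (v *m U^t*)^t*.
  by rewrite adjmxM adjmxK !mulmxA.
rewrite mul_mx_diag mxE; apply: eq_bigr => k _.
by rewrite !mxE normCK mulrAC mulrC.
Qed.

Lemma unitary_norm (v : 'rV[C]_n) :
  (v *m v^t*) 0 0 = \sum_k `|(v *m U^t*) 0 k| ^+ 2.
Proof. by rewrite -row_dotE adjmxM adjmxK mulmxA -(mulmxA v) unitary_mull mulmx1. Qed.

Lemma psd_udiag f : psd (udiag U f) <-> forall k, 0 <= f k.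
Proof.
split=> [hp k|f0 v]; last first.
  rewrite udiag_form sumr_ge0 // => k _.
  by rewrite mulr_ge0 ?exprn_ge0 // (lecR 0).
(* Row k of U is an eigenvector for f k, so the form at it isolates this eigenvalue. *)
have := hp (row k U); rewrite udiag_form (bigD1 k) //= big1 => [|j jk].
  rewrite -row_mul unitary_mulr !mxE eqxx normr1 expr1n mulr1 addr0.
  by rewrite (lecR 0).
rewrite -row_mul unitary_mulr !mxE eq_sym (negPf jk) normr0.
by rewrite expr0n mulr0.
Qed.

Lemma char_poly_udiag f :
  char_poly (udiag U f) = \prod_k ('X - ((f k)%:C)%:P).
Proof.
rewrite /udiag char_poly_conj ?unitary_mulr // char_poly_trig.
  by apply: eq_bigr => k _; rewrite !mxE eqxx mulr1n.
exact: diag_mx_is_trig.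
Qed.

End Udiag.

(** * Ordered spectra of Hermitian matrices and their monotonicity *)

Lemma prod_XsubC_real_perm (s t : seq R) :
  \prod_(a <- s) ('X - (a%:C)%:P) = \prod_(a <- t) ('X - (a%:C)%:P) :> {poly C} ->
  perm_eq s t.
Proof.
rewrite -!(big_map (fun a => a%:C) xpredT (fun a => 'X - a%:P)).
move/prod_XsubC_eq => h; apply: (perm_map_inj (@complexI R)); exact: h.
Qed.

Lemma size_char_poly_roots n (M : 'M[C]_n) (s : seq R) :
  char_poly M = \prod_(a <- s) ('X - (a%:C)%:P) -> size s = n.
Proof.
move/(congr1 (fun p : {poly C} => size p)).
by rewrite size_char_poly size_prod_XsubC => -[].
Qed.

Lemma hermitian_udiag n (M : 'M[C]_n) : M^t* = M ->
  exists U (f : 'I_n -> R), U \is unitarymx /\ M = udiag U f.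
Proof.
move=> hM; have Mh : M \is hermsymmx.
  by apply/is_hermitianmxP; rewrite expr0 scale1r hM.
exists (spectralmx M), (fun i => complex.Re (spectral_diag M 0 i)).
split; first exact: spectral_unitarymx.
rewrite {1}(orthomx_spectralP (hermitian_normalmx Mh)).
rewrite (invmx_unitary (spectral_unitarymx M)) /udiag.
apply: (congr1 (fun d => _^t* *m diag_mx d *m _)); apply/rowP => k.
rewrite mxE RRe_real //.
by move/mxOverP: (hermitian_spectral_diag_real Mh); apply.
Qed.

(** The spectral theorem lists the eigenvalues in some order; a permutation of the rows of U brings
    them to the order of s. *)
Lemma hermitian_udiag_roots n (M : 'M[C]_n) (s : seq R) : M^t* = M ->
  char_poly M = \prod_(a <- s) ('X - (a%:C)%:P) ->
  exists2 U : 'M_n, U \is unitarymx & M = udiag U (fun i => s`_i).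
Proof.
move=> /hermitian_udiag [U [f [hU ->]]]; rewrite char_poly_udiag // => fs.
have : perm_eq s [tuple f i | i < n].
  by apply/prod_XsubC_real_perm; rewrite -fs big_image.
case/tuple_permP => p sE; exists (row_perm p U).
  apply/unitarymxP; rewrite row_permE adjmxM mulmxA -(mulmxA _ U).
  rewrite unitary_mulr // mulmx1.
  rewrite tr_perm_mx map_perm_mx -perm_mxM mulgV; exact: perm_mx1.
apply/matrixP => i j; rewrite !udiagE (reindex_inj (@perm_inj _ p)) /=.
apply: eq_bigr => k _; rewrite !mxE sE.
by rewrite (nth_map k) ?size_enum_ord // nth_ord_enum tnth_map tnth_ord_tuple.
Qed.

Definition eigs n (M : 'M[C]_n) (s : seq R) :=
  sorted >=%R s /\ char_poly M = \prod_(a <- s) ('X - (a%:C)%:P).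

Lemma eigs_size n (M : 'M[C]_n) s : eigs M s -> size s = n.
Proof. by case=> _ /size_char_poly_roots. Qed.

Lemma eigs_exists n (M : 'M[C]_n) : M^t* = M -> exists s, eigs M s.
Proof.
move=> /hermitian_udiag [U [f [hU ->]]]; exists (sort >=%R (codom f)); split.
  by apply: sort_sorted; exact: ge_total.
rewrite char_poly_udiag //.
by rewrite (perm_big _ (permEl (perm_sort _ _))) /= big_image.
Qed.

Lemma eigs_udiag n (M : 'M[C]_n) s : M^t* = M -> eigs M s ->
  exists2 U : 'M_n, U \is unitarymx & M = udiag U (fun i => s`_i).
Proof. by move=> hM [_]; exact: hermitian_udiag_roots. Qed.

Lemma eigs_tr n (M : 'M[C]_n) s : M^t* = M -> eigs M s ->
  \tr M = (\sum_(i < n) s`_i)%:C.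
Proof. by move=> hM /(eigs_udiag hM)[U hU ->]; rewrite udiag_tr. Qed.

Lemma eigs_ge0 n (M : 'M[C]_n) s : M^t* = M -> psd M -> eigs M s ->
  forall i, 0 <= s`_i.
Proof.
(* Past the end of s the default entry is 0, so the bound holds for every i. *)
move=> hM pM es i; case: (ltnP i (size s)) => [|si]; last by rewrite nth_default.
rewrite (eigs_size es) => ni; have [U hU ME] := eigs_udiag hM es.
by move: pM; rewrite ME => /(psd_udiag hU)/(_ (Ordinal ni)).
Qed.

Lemma psd_sqrt n (M : 'M[C]_n) : M^t* = M -> psd M ->
  exists2 B : 'M[C]_n, B^t* = B & B *m B = M.
Proof.
move=> /hermitian_udiag [U [f [hU ->]]] /(psd_udiag hU) f0.
exists (udiag U (fun i => Num.sqrt (f i))); first exact: udiag_adj.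
rewrite (udiagM hU); apply: (congr1 (udiag U)); apply: boolp.funext => i.
by rewrite -expr2 sqr_sqrtr.
Qed.

(* F is the positive part of D - c. *)
Lemma psd_pos_part n (D : 'M[C]_n) (d : seq R) c : D^t* = D ->
  char_poly D = \prod_(a <- d) ('X - (a%:C)%:P) ->
  exists F : 'M[C]_n, [/\ F^t* = F, psd F, psd (F + (c%:C)%:M - D) &
    \tr F = (\sum_(a <- d) Num.max (a - c) 0)%:C].
Proof.
move=> hD dD; have [U hU DE] := hermitian_udiag_roots hD dD.
have sd := size_char_poly_roots dD.
exists (udiag U (fun i => Num.max (d`_i - c) 0)); split.
- exact: udiag_adj.
- by apply/psd_udiag => // k; rewrite le_max lexx orbT.
- rewrite DE (udiag_cst hU) udiagD udiagB; apply/psd_udiag => // k.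
  by rewrite subr_ge0 -lerBlDr le_max lexx.
- rewrite udiag_tr //; congr (_%:C).
  by rewrite (big_nth 0) sd big_mkord.
Qed.

(* Courant-Fischer: the span of the first i+1 eigenvectors of M meets the span
   of the eigenvectors of N of index >= i. *)
Lemma eigs_le n (M N : 'M[C]_n) (c : R) s t :
  M^t* = M -> N^t* = N -> psd (N + (c%:C)%:M - M) ->
  eigs M s -> eigs N t -> forall i, (i < n)%N -> s`_i <= t`_i + c.
Proof.
move=> hM hN hp es et i ni.
have [U hU ME] := eigs_udiag hM es; have [V hV NE] := eigs_udiag hN et.
have ss := proj1 es; have st := proj1 et.
have sn := eigs_size es; have tn := eigs_size et.
pose X1 := (pid_mx i.+1 : 'M[C]_n) *m U; pose X2 := (copid_mx i : 'M[C]_n) *m V.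
have r1 : \rank X1 = i.+1.
  by rewrite mxrankMfree ?rank_pid_mx // row_free_unit unitarymx_unit.
have r2 : \rank X2 = (n - i)%N.
  rewrite mxrankMfree ?rank_copid_mx 1?ltnW //.
  by rewrite row_free_unit unitarymx_unit.
(* The ranks i + 1 and n - i add up to n + 1, so the two spans share a nonzero v. *)
have /rowV0Pn [v /[!sub_capmx] /andP[v1 v2] v0] : (X1 :&: X2)%MS != 0.
  rewrite -mxrank_eq0 -lt0n; have := mxrank_sum_cap X1 X2.
  have := rank_leq_row (X1 + X2)%MS; rewrite r1 r2 => h1 h2.
  rewrite -(ltn_add2l (\rank (X1 + X2)%MS)) h2 addn0.
  by rewrite (leq_ltn_trans h1) // addSn subnKC // ltnW.
have w1 (k : 'I_n) : (i < k)%N -> (v *m U^t*) 0 k = 0.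
  move=> ik; case/submxP: v1 => x ->.
  rewrite /X1 -!mulmxA (unitary_mulr hU) mulmx1 mxE big1 // => j _.
  by rewrite mxE; case: eqP => [->|_]; rewrite ?ltnS 1?leqNgt ?ik mulr0.
have w2 (k : 'I_n) : (k < i)%N -> (v *m V^t*) 0 k = 0.
  move=> ik; case/submxP: v2 => x ->.
  rewrite /X2 -!mulmxA (unitary_mulr hV) mulmx1 mxE big1 // => j _.
  rewrite !mxE; case: (eqVneq j k) => [->|/negPf jk].
    by rewrite eqxx ik subrr mulr0.
  by rewrite val_eqE jk subr0 mulr0.
have vpos : 0 < (v *m v^t*) 0 0.
  rewrite lt_def row_dotE sumr_ge0 ?andbT => [|k _]; last by rewrite exprn_ge0.
  apply: contra v0; rewrite psumr_eq0 => [/allP h|k _]; last by rewrite exprn_ge0.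
  apply/eqP/rowP => k; have := h k (mem_index_enum _).
  by rewrite sqrf_eq0 normr_eq0 mxE => /eqP.
(* On v, the Rayleigh quotient of M is at least s_i and that of N at most t_i. *)
have qM : (s`_i)%:C * (v *m v^t*) 0 0 <= (v *m M *m v^t*) 0 0.
  rewrite ME udiag_form (unitary_norm hU) mulr_sumr; apply: ler_sum => k _.
  case: (ltnP i k) => ik; first by rewrite w1 // normr0 expr0n !mulr0.
  rewrite ler_wpM2r ?exprn_ge0 // lecR.
  by apply: (sorted_leq_nth ge_trans ge_refl) => //; rewrite inE sn.
have qN : (v *m N *m v^t*) 0 0 <= (t`_i)%:C * (v *m v^t*) 0 0.
  rewrite NE udiag_form (unitary_norm hV) mulr_sumr; apply: ler_sum => k _.
  case: (ltnP k i) => ik; first by rewrite w2 // normr0 expr0n !mulr0.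
  rewrite ler_wpM2r ?exprn_ge0 // lecR.
  by apply: (sorted_leq_nth ge_trans ge_refl) => //; rewrite inE tn.
have := hp v; rewrite mulmxBr mulmxDr mulmxBl mulmxDl mul_mx_scalar -scalemxAl.
rewrite 2!mxE [X in _ + X]mxE [X in _ + X - _]mxE => hv.
rewrite -lecR -(ler_pM2r vpos) real_complexD mulrDl (le_trans qM) //.
rewrite subr_ge0 in hv; rewrite (le_trans hv) //.
by rewrite lerD2r.
Qed.

(** * Spectra of affine images and of Gram matrices *)

Lemma scalar_mx_real0 n : ((0 : R)%:C)%:M = 0 :> 'M[C]_n.
Proof. by apply/matrixP => i j; rewrite !mxE mul0rn. Qed.

Lemma herm_congr m n (B : 'M[C]_(m, n)) (M : 'M[C]_n) :
  M^t* = M -> (B *m M *m B^t*)^t* = B *m M *m B^t*.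
Proof. by move=> hM; rewrite !adjmxM adjmxK hM mulmxA. Qed.

Lemma char_poly_affine n (M : 'M[C]_n) (c : seq R) (e b : R) : M^t* = M ->
  char_poly M = \prod_(a <- c) ('X - (a%:C)%:P) ->
  char_poly (e%:C *: M + (b%:C)%:M) =
  \prod_(a <- c) ('X - ((e * a + b)%:C)%:P).
Proof.
move=> hM cM; have [U hU ->] := hermitian_udiag_roots hM cM.
have cn := size_char_poly_roots cM.
rewrite (udiag_cst hU) udiagZ udiagD (char_poly_udiag hU).
by rewrite (big_nth 0) cn big_mkord.
Qed.

Lemma eigs_shift n (M : 'M[C]_n) s (b : R) : M^t* = M -> eigs M s ->
  eigs (M + (b%:C)%:M) [seq a + b | a <- s].
Proof.
move=> hM [ss cs]; split.
  rewrite sorted_map; apply: sub_sorted ss => x y /= xy.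
  by rewrite lerD2r.
have := char_poly_affine 1 b hM cs; rewrite rmorph1 scale1r big_map => ->.
by apply: eq_bigr => a _; rewrite mul1r.
Qed.

Lemma eigs_opp n (M : 'M[C]_n) s : M^t* = M -> eigs M s ->
  eigs (- M) (rev [seq - a | a <- s]).
Proof.
move=> hM [ss cs]; split.
  rewrite rev_sorted sorted_map; apply: sub_sorted ss => x y /= xy.
  by rewrite lerN2.
have := char_poly_affine (-1) 0 hM cs.
rewrite rmorphN rmorph1 scaleN1r scalar_mx_real0 addr0 => ->.
rewrite (perm_big _ (permEl (perm_rev _))) /= big_map.
by apply: eq_bigr => a _; rewrite mulN1r addr0.
Qed.

(** No eigenvalue of Z^* Z is negative, so the n - m extra zeros of Z Z^* can be put at the end
    without breaking the order. *)
Lemma eigs_gram m n (Z : 'M[C]_(n, m)) s : (m <= n)%N ->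
  eigs (Z^t* *m Z) s -> eigs (Z *m Z^t*) (s ++ nseq (n - m) 0).
Proof.
move=> mn es; have [ss cs] := es; split.
  have hZ : (Z^t* *m Z)^t* = Z^t* *m Z by rewrite adjmxM adjmxK.
  have pZ : psd (Z^t* *m Z) by rewrite -{2}(adjmxK Z); apply: psd_gram.
  have s0 : all (>= 0) s by apply/(all_nthP 0) => i _; apply: eigs_ge0 es i.
  rewrite (sorted_pairwise ge_trans) pairwise_cat -!(sorted_pairwise ge_trans).
  rewrite ss /=; apply/andP; split.
    by apply/allrelP => x y /(allP s0) x0 /nseqP[-> _].
  by elim: (n - m)%N => [|[|k] IH] //=; rewrite lexx.
have := char_poly_mulmxC Z (Z^t*).
have -> : 'X^n = 'X^m * 'X^(n - m) :> {poly C} by rewrite -exprD subnKC.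
rewrite cs -mulrA => /(mulfI (monic_neq0 (monicXn _ _))) ->.
rewrite big_cat /= mulrC; congr (_ * _).
by rewrite big_nseq iter_mulr_1 subr0.
Qed.

(** * One-sided bounds on eigenvalue differences *)

(** With r the spectrum of B (Q + F) B^*, both s_i - tau delta and t_i are at most r_i; so each
    positive part is at most r_i - t_i, and these increments sum to the trace of B F B^*. *)
Lemma one_sided_bound n (P Q F B : 'M[C]_n) (tau delta : R) s t :
  P^t* = P -> Q^t* = Q -> F^t* = F -> 0 <= tau ->
  psd (Q + F + (tau%:C)%:M - P) -> psd F ->
  psd ((delta%:C)%:M - B *m B^t*) ->
  eigs (B *m P *m B^t*) s -> eigs (B *m Q *m B^t*) t ->
  (\sum_(i < n) Num.max (s`_i - t`_i - tau * delta) 0)%:C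
    <= \tr (B *m F *m B^t*).
Proof.
move=> hP hQ hF tau0 pQF pF pB es et.
have hBP := herm_congr B hP; have hBQ := herm_congr B hQ.
have hBF := herm_congr B hF; have pBF := psd_congr B pF.
have hN : (B *m Q *m B^t* + B *m F *m B^t*)^t* =
    B *m Q *m B^t* + B *m F *m B^t* by rewrite adjmxD hBQ hBF.
have [r er] := eigs_exists hN.
have sr : forall i, (i < n)%N -> s`_i <= r`_i + tau * delta.
  apply: (eigs_le hBP hN _ es er).
  have := psdD (psd_congr B pQF) (psdZ tau0 pB); congr psd.
  rewrite mulmxBr mulmxBl !mulmxDr !mulmxDl mul_mx_scalar -scalemxAl.
  rewrite scalerBr scale_scalar_mx -real_complexM.
  by rewrite (addrAC _ (tau%:C *: _)) addrACA subrr addr0 addrAC.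
have le_tr : forall i, (i < n)%N -> t`_i <= r`_i.
  move=> i ni; rewrite -[r`_i]addr0; move: i ni.
  apply: (eigs_le hBQ hN _ et er).
  by rewrite scalar_mx_real0 addr0 addrAC subrr add0r.
have := eigs_tr hN er; rewrite raddfD /= (eigs_tr hBQ et) => trE.
have -> : \tr (B *m F *m B^t*) = (\sum_(i < n) (r`_i - t`_i))%:C.
  by rewrite sumrB real_complexB -trE addrC addKr.
rewrite lecR; apply: ler_sum => i _.
by rewrite ge_max subr_ge0 le_tr // andbT lerBlDr lerBlDr addrAC subrK sr.
Qed.

Lemma scalar_mx_realN n (a : R) : ((- a)%:C)%:M = - (a%:C)%:M :> 'M[C]_n.
Proof. by rewrite real_complexN raddfN. Qed.

Lemma scalar_mx_realB n (a b : R) :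
  ((a - b)%:C)%:M = (a%:C)%:M - (b%:C)%:M :> 'M[C]_n.
Proof. by rewrite real_complexB raddfB. Qed.

Lemma proj_herm m n (X : 'M[C]_(m, n)) : (X^t* *m X)^t* = X^t* *m X.
Proof. by rewrite adjmxM adjmxK. Qed.

Lemma herm_sub_scalar n (A : 'M[C]_n) (c : R) :
  A^t* = A -> (A - (c%:C)%:M)^t* = A - (c%:C)%:M.
Proof. by move=> hA; rewrite adjmxD adjmxN hA adjmx_scalar. Qed.

Lemma compress_sub_scalar m n (X : 'M[C]_(m, n)) (A : 'M[C]_n) (c : R) :
  X \is unitarymx ->
  X *m (A - (c%:C)%:M) *m X^t* = X *m A *m X^t* + ((- c)%:C)%:M.
Proof.
move=> /unitarymxP hX.
rewrite mulmxBr mulmxBl mul_mx_scalar -scalemxAl hX scalemx1.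
by rewrite scalar_mx_realN.
Qed.

Lemma psd_gap n (A : 'M[C]_n) (l u : R) :
  psd ((u%:C)%:M - A) -> psd (((u - l)%:C)%:M - (A - (l%:C)%:M)).
Proof.
congr psd; rewrite scalar_mx_realB opprB addrA.
by congr (_ - _); rewrite subrK.
Qed.

Lemma nth_map_shift (s : seq R) (c : R) i : (i < size s)%N ->
  [seq a + c | a <- s]`_i = s`_i + c.
Proof. by move=> si; rewrite (nth_map 0). Qed.

(** The conditions on F do not involve A, so one F serves for both A and -A. *)
Lemma ritz_bound m n (X Y : 'M[C]_(m, n)) (A F : 'M[C]_n) (l u tau : R) s t :
  X \is unitarymx -> Y \is unitarymx -> A^t* = A -> F^t* = F -> 0 <= tau ->
  psd (A - (l%:C)%:M) -> psd ((u%:C)%:M - A) ->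
  psd (Y^t* *m Y + F + (tau%:C)%:M - X^t* *m X) -> psd F ->
  eigs (X *m A *m X^t*) s -> eigs (Y *m A *m Y^t*) t ->
  (\sum_(i < m) Num.max (s`_i - t`_i - tau * (u - l)) 0)%:C
    <= \tr (F *m (A - (l%:C)%:M)).
Proof.
move=> hX hY hA hF tau0 pl pu pF0 pF es et.
have [B hB BB] := psd_sqrt (herm_sub_scalar l hA) pl.
have mn : (m <= n)%N by rewrite -(mxrank_unitary hX) rank_leq_col.
(* For W = B Z^*, the matrix W^* W is the compression of A - l, while W W^* = B Z^* Z B; the spectra
   agree up to n - m zeros. *)
have gram (Z : 'M[C]_(m, n)) z : Z \is unitarymx -> eigs (Z *m A *m Z^t*) z ->
    eigs (B *m (Z^t* *m Z) *m B^t*) ([seq a - l | a <- z] ++ nseq (n - m) 0).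
  move=> hZ ez.
  have -> : B *m (Z^t* *m Z) *m B^t* = (B *m Z^t*) *m (B *m Z^t*)^t*.
    by rewrite adjmxM adjmxK !mulmxA.
  apply: eigs_gram => //; rewrite adjmxM adjmxK hB mulmxA -(mulmxA Z) BB.
  rewrite (compress_sub_scalar A l hZ); apply: eigs_shift ez.
  exact: herm_congr.
have pd : psd (((u - l)%:C)%:M - B *m B^t*) by rewrite hB BB; apply: psd_gap.
have := one_sided_bound (proj_herm X) (proj_herm Y) hF tau0 pF0 pF pd
  (gram X s hX es) (gram Y t hY et).
rewrite -mulmxA mxtrace_mulC -mulmxA hB BB; apply: le_trans.
(* The padded spectra have n entries: terms of index at least m are nonnegative and are dropped, and
   in the others the shift by l cancels. *)
rewrite lecR (big_ord_widen n (fun i => Num.max (s`_i - t`_i - tau * (u - l)) 0)) //.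
rewrite [X in _ <= X](bigID (fun i : 'I_n => (i < m)%N)) /= ler_wpDr //.
  by apply: sumr_ge0 => i _; rewrite le_max lexx orbT.
apply: ler_sum => i im; have sm := eigs_size es; have tm := eigs_size et.
rewrite !nth_cat !size_map sm tm im !nth_map_shift ?sm ?tm //.
by rewrite opprD (addrACA s`_i) subrr addr0 lexx.
Qed.

(* As X reduces A, Y (A - l) Y^* dominates K^* (M - l) K, which has the same
   eigenvalues as B K K^* B for B = (M - l)^(1/2). *)
Lemma ritz_bound_invariant m n (X Y : 'M[C]_(m, n)) (A : 'M[C]_n)
    (F : 'M[C]_m) (l u tau : R) s t :
  let M := X *m A *m X^t* in let K := X *m Y^t* in
  X \is unitarymx -> Y \is unitarymx -> A^t* = A -> F^t* = F -> 0 <= tau ->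
  X *m A = M *m X ->
  psd (A - (l%:C)%:M) -> psd ((u%:C)%:M - A) ->
  psd (K *m K^t* + F + (tau%:C)%:M - 1%:M) -> psd F ->
  eigs M s -> eigs (Y *m A *m Y^t*) t ->
  (\sum_(i < m) Num.max (s`_i - t`_i - tau * (u - l)) 0)%:C
    <= \tr (F *m (M - (l%:C)%:M)).
Proof.
move=> M K hX hY hA hF tau0 XA pl pu pF0 pF es et.
have XX := unitarymxP hX; have YY := unitarymxP hY.
have hM : M^t* = M by exact: herm_congr.
have hMl := herm_sub_scalar l hM.
have pMl : psd (M - (l%:C)%:M).
  have := psd_congr X pl; rewrite (compress_sub_scalar A l hX).
  by rewrite scalar_mx_realN.
have pMu : psd ((u%:C)%:M - M).
  have := psd_congr X pu; rewrite mulmxBr mulmxBl mul_mx_scalar -scalemxAl.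
  by rewrite XX scalemx1.
have [B hB BB] := psd_sqrt hMl pMl.
have pd : psd (((u - l)%:C)%:M - B *m B^t*) by rewrite hB BB; apply: psd_gap.
have hKK : (K *m K^t*)^t* = K *m K^t* by rewrite adjmxM adjmxK.
have [t' et'] := eigs_exists (herm_congr B hKK).
have es' : eigs (B *m 1%:M *m B^t*) [seq a - l | a <- s].
  rewrite mulmx1 hB BB -scalar_mx_realN; exact: eigs_shift.
have h1 : (1%:M : 'M[C]_m)^t* = 1%:M by rewrite trmx1 map_mx1.
have := one_sided_bound h1 hKK hF tau0 pF0 pF pd es' et'.
rewrite -mulmxA mxtrace_mulC -mulmxA hB BB; apply: le_trans.
have sm := eigs_size es; have tm := eigs_size et.
have hN : (Y *m A *m Y^t*)^t* = Y *m A *m Y^t* by exact: herm_congr.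
have le_t i : (i < m)%N -> t'`_i <= t`_i - l.
  move=> im; rewrite -nth_map_shift ?tm //.
  have hL : (K^t* *m (M - (l%:C)%:M) *m K)^t* = K^t* *m (M - (l%:C)%:M) *m K.
    by have := herm_congr (K^t*) hMl; rewrite adjmxK.
  (* Cyclic exchange of the square factors K^* B and B K. *)
  have et2 : eigs (K^t* *m (M - (l%:C)%:M) *m K) t'.
    split; [exact: (proj1 et') | rewrite -(proj2 et')].
    have /(mulfI (monic_neq0 (monicXn _ _))) := char_poly_mulmxC (K^t* *m B) (B *m K).
    by rewrite -BB hB !mulmxA => ->.
  have et3 : eigs (Y *m (A - (l%:C)%:M) *m Y^t*) [seq a - l | a <- t].
    rewrite (compress_sub_scalar A l hY); exact: eigs_shift.
  rewrite -[X in _ <= X]addr0.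
  apply: (eigs_le hL _ _ et2 et3) im; first by apply: herm_congr (herm_sub_scalar _ hA).
  rewrite scalar_mx_real0 addr0.
  (* P commutes with A', so A' - T = Q A' Q is the part of A' on the complement of X, positive like
     A'. Conjugation by Y turns T into K^* (M - l) K. *)
  pose A' := A - (l%:C)%:M; pose P := X^t* *m X; pose Q := 1%:M - P.
  pose T := X^t* *m (M - (l%:C)%:M) *m X.
  have hQ : Q^t* = Q by rewrite adjmxD adjmxN proj_herm trmx1 map_mx1.
  have PA : P *m A' = T.
    rewrite /P /T -!mulmxA; congr (_ *m _).
    by rewrite mulmxBr mulmxBl XA mul_mx_scalar mul_scalar_mx.
  have AP : A' *m P = T.
    have <- : T^t* = T by have := herm_congr (X^t*) hMl; rewrite adjmxK.
    by rewrite -PA adjmxM proj_herm (herm_sub_scalar _ hA).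
  have TP : T *m P = T by rewrite /T /P -!mulmxA (mulmxA X) XX mul1mx.
  have QAQ : Q *m A' *m Q = A' - T.
    exact: compl_conj_mx.
  have := psd_congr Y (psd_congr Q pl); congr psd.
  by rewrite hQ QAQ mulmxBr mulmxBl /T /K adjmxM adjmxK !mulmxA.
have -> : \sum_(i < m) Num.max (s`_i - t`_i - tau * (u - l)) 0 =
  \sum_(i < m) Num.max (s`_i - l - (t`_i - l) - tau * (u - l)) 0.
  by apply: eq_bigr => i _; rewrite opprD (addrACA s`_i) subrr addr0.
rewrite lecR; apply: ler_sum => i _.
rewrite nth_map_shift ?sm // ge_max !le_max lexx orbT andbT.
by rewrite lerD2r lerD2l lerN2 le_t.
Qed.

(** * Difference of two projectors *)

(** For K = X Y^*, 1 - K K^* is the compression by X of the projector 1 - Y^* Y. This bounds the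
    squared cosines by 1. *)
Lemma psd_one_sub_gram m p n (X : 'M[C]_(m, n)) (Y : 'M[C]_(p, n)) :
  X \is unitarymx -> Y \is unitarymx ->
  psd (1%:M - X *m Y^t* *m (X *m Y^t*)^t*).
Proof.
move=> /unitarymxP XX /unitarymxP YY.
have PP : Y^t* *m Y *m (Y^t* *m Y) = Y^t* *m Y.
  by rewrite -!mulmxA (mulmxA Y) YY mul1mx.
have := psd_congr X (psd_congr (1%:M - Y^t* *m Y) (@psd1 n)); congr psd.
rewrite adjmxD adjmxN proj_herm trmx1 map_mx1.
rewrite (compl_conj_mx _ _ PP) ?mulmx1 ?mul1mx //.
by rewrite mulmxBr mulmxBl mulmx1 XX adjmxM adjmxK !mulmxA.
Qed.

Lemma gram_herm m n (X : 'M[C]_(m, n)) : (X *m X^t*)^t* = X *m X^t*.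
Proof. by rewrite adjmxM adjmxK. Qed.

(* X^* X - Y^* Y = [X^* Y^*] [X; -Y]; exchanging the two factors leaves a
   2 x 2 block matrix of m x m blocks. *)
Lemma char_poly_proj_diff m n (X Y : 'M[C]_(m, n)) (c : seq R) :
  X \is unitarymx -> Y \is unitarymx ->
  char_poly (1%:M - X *m Y^t* *m (X *m Y^t*)^t*) =
    \prod_(a <- c) ('X - ((a ^+ 2)%:C)%:P) ->
  'X^(m + m) * char_poly (X^t* *m X - Y^t* *m Y) =
  'X^n * \prod_(a <- c) (('X - (a%:C)%:P) * ('X - ((- a)%:C)%:P)).
Proof.
move=> /unitarymxP XX /unitarymxP YY cK.
have -> : X^t* *m X - Y^t* *m Y = row_mx (X^t*) (Y^t*) *m col_mx X (- Y).
  by rewrite mul_row_col mulmxN.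
rewrite char_poly_mulmxC; congr (_ * _).
have -> : col_mx X (- Y) *m row_mx (X^t*) (Y^t*) =
    block_mx 1%:M (X *m Y^t*) (- ((X *m Y^t*)^t*)) (- 1%:M).
  by rewrite mul_col_row XX !mulNmx YY adjmxM adjmxK.
rewrite char_poly_block cK rmorph_prod /=; apply: eq_bigr => a _.
rewrite rmorphB /= comp_polyX comp_polyC real_complexN polyCN opprK.
by rewrite -subr_sqr -polyC_exp -rmorphXn.
Qed.

(** The spectrum of the difference consists of c, its opposite and zeros; as tau is nonnegative,
    only entries of c can exceed it, so the trace counts each sine once. *)
Lemma proj_diff_pos_part m n (X Y : 'M[C]_(m, n)) (c : seq R) (tau : R) :
  X \is unitarymx -> Y \is unitarymx -> all (>= 0) c -> 0 <= tau ->
  char_poly (1%:M - X *m Y^t* *m (X *m Y^t*)^t*) =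
    \prod_(a <- c) ('X - ((a ^+ 2)%:C)%:P) ->
  exists F : 'M[C]_n, [/\ F^t* = F, psd F,
    psd (Y^t* *m Y + F + (tau%:C)%:M - X^t* *m X) &
    \tr F = (\sum_(a <- c) Num.max (a - tau) 0)%:C].
Proof.
move=> hX hY c0 tau0 cK.
have hD : (X^t* *m X - Y^t* *m Y)^t* = X^t* *m X - Y^t* *m Y.
  by rewrite adjmxD adjmxN !proj_herm.
have [d ed] := eigs_exists hD.
have [F [hF pF pFD trF]] := psd_pos_part tau hD (proj2 ed).
exists F; split; [exact: hF | exact: pF | |].
  by move: pFD; congr psd; rewrite opprB addrA [F + _ + _]addrC addrA.
rewrite trF; congr (_%:C).
have := char_poly_proj_diff hX hY cK; rewrite (proj2 ed) => E.
(* Zeros are added on both sides, since n may be smaller or larger than 2m. *)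
have pE : perm_eq (nseq (m + m) 0 ++ d) (nseq n 0 ++ c ++ [seq - a | a <- c]).
  apply: prod_XsubC_real_perm; rewrite !big_cat /= !big_nseq !iter_mulr_1.
  by rewrite !subr0 big_map -big_split.
have z0 k : \sum_(a <- nseq k 0) Num.max (a - tau) 0 = 0 :> R.
  by rewrite big1_seq // => a /= /nseqP[-> _]; apply/max_idPr; rewrite sub0r oppr_le0.
have := perm_big _ pE (op := +%R) (x := 0) (P := xpredT)
  (F := fun a => Num.max (a - tau) 0).
rewrite /= !big_cat /= !z0 !add0r => ->.
rewrite big_map [X in _ + X]big1_seq ?addr0 // => a /= /(allP c0) a0.
by apply/max_idPr; rewrite subr_le0 (le_trans _ tau0) // oppr_le0.
Qed.

(** * Two-sided bounds on eigenvalue differences *)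

Lemma max_abs_le (x c : R) :
  Num.max (`|x| - c) 0 <= Num.max (x - c) 0 + Num.max (- x - c) 0.
Proof.
rewrite ge_max addr_ge0 ?le_max ?lexx ?orbT // andbT.
by case: (ger0P x) => _; [rewrite ler_wpDr //|rewrite ler_wpDl //];
  rewrite le_max lexx ?orbT.
Qed.

(** The spectrum of -A is the reversed opposite of that of A; reindexed backwards, the second sum
    carries the opposite differences, index by index. *)
Lemma sum_max_abs_le m (s t : seq R) (c b : R) :
  size s = m -> size t = m ->
  \sum_(i < m) Num.max (s`_i - t`_i - c) 0 +
  \sum_(i < m) Num.max ((rev [seq - a | a <- s])`_i -
    (rev [seq - a | a <- t])`_i - c) 0 <= b ->
  \sum_(i < m) Num.max (`|s`_i - t`_i| - c) 0 <= b.
Proof.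
move=> sm tm; apply: le_trans; rewrite [X in _ <= _ + X](reindex_inj rev_ord_inj).
rewrite -big_split; apply: ler_sum => i _ /=.
have nr (r : seq R) : size r = m -> (rev [seq - a | a <- r])`_(m - i.+1) = - r`_i.
  move=> rm; rewrite nth_rev size_map rm; last by rewrite subnSK // leq_subr.
  by rewrite subnSK // subKn 1?ltnW // (nth_map 0) ?rm.
by rewrite !nr // -[X in _ <= _ + Num.max (X - _) _]opprD max_abs_le.
Qed.

(* The bounds for A and for -A add up because (A - l) + (u - A) = u - l. *)
Lemma ritz_change m n (X Y : 'M[C]_(m, n)) (A : 'M[C]_n) (l u tau : R) s t c :
  X \is unitarymx -> Y \is unitarymx -> A^t* = A -> 0 <= tau ->
  psd (A - (l%:C)%:M) -> psd ((u%:C)%:M - A) ->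
  eigs (X *m A *m X^t*) s -> eigs (Y *m A *m Y^t*) t ->
  all (>= 0) c ->
  char_poly (1%:M - X *m Y^t* *m (X *m Y^t*)^t*) =
    \prod_(a <- c) ('X - ((a ^+ 2)%:C)%:P) ->
  \sum_(i < m) Num.max (`|s`_i - t`_i| - tau * (u - l)) 0
    <= (u - l) * \sum_(a <- c) Num.max (a - tau) 0.
Proof.
move=> hX hY hA tau0 pl pu es et c0 cK.
have [F [hF pF pFD trF]] := proj_diff_pos_part hX hY c0 tau0 cK.
have b1 := ritz_bound hX hY hA hF tau0 pl pu pFD pF es et.
have hNA : (- A)^t* = - A by rewrite adjmxN hA.
have hXA := herm_congr X hA; have hYA := herm_congr Y hA.
have es' := eigs_opp hXA es; have et' := eigs_opp hYA et.
rewrite -mulNmx -mulmxN in es'; rewrite -mulNmx -mulmxN in et'.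
have pl' : psd (- A - ((- u)%:C)%:M).
  by rewrite scalar_mx_realN opprK addrC; exact: pu.
have pu' : psd (((- l)%:C)%:M - - A).
  by rewrite scalar_mx_realN opprK addrC; exact: pl.
have b2 := ritz_bound hX hY hNA hF tau0 pl' pu' pFD pF es' et'.
rewrite opprK [- l + u]addrC in b2.
apply: sum_max_abs_le; [exact: eigs_size es | exact: eigs_size et |].
rewrite -lecR real_complexD (le_trans (lerD b1 b2)) //.
rewrite -mxtraceD -mulmxDr.
have -> : A - (l%:C)%:M + (- A - ((- u)%:C)%:M) = ((u - l)%:C)%:M.
  by rewrite addrACA subrr add0r scalar_mx_realN opprK addrC scalar_mx_realB.
by rewrite mul_mx_scalar mxtraceZ trF -real_complexM.
Qed.

(** Here F is the positive part of 1 - K K^* - tau, so c lists the squared sines, where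
    [ritz_change] has their square roots. *)
Lemma ritz_change_invariant m n (X Y : 'M[C]_(m, n)) (A : 'M[C]_n)
    (l u tau : R) s t c :
  X \is unitarymx -> Y \is unitarymx -> A^t* = A -> 0 <= tau ->
  X *m A = X *m A *m X^t* *m X ->
  psd (A - (l%:C)%:M) -> psd ((u%:C)%:M - A) ->
  eigs (X *m A *m X^t*) s -> eigs (Y *m A *m Y^t*) t ->
  char_poly (1%:M - X *m Y^t* *m (X *m Y^t*)^t*) =
    \prod_(a <- c) ('X - (a%:C)%:P) ->
  \sum_(i < m) Num.max (`|s`_i - t`_i| - tau * (u - l)) 0
    <= (u - l) * \sum_(a <- c) Num.max (a - tau) 0.
Proof.
move=> hX hY hA tau0 XA pl pu es et cK.
have hG : (1%:M - X *m Y^t* *m (X *m Y^t*)^t*)^t* =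
    1%:M - X *m Y^t* *m (X *m Y^t*)^t*.
  by rewrite adjmxD adjmxN gram_herm trmx1 map_mx1.
have [F [hF pF pFD trF]] := psd_pos_part tau hG cK.
have {}pFD : psd (X *m Y^t* *m (X *m Y^t*)^t* + F + (tau%:C)%:M - 1%:M).
  by move: pFD; congr psd; rewrite opprB addrA [F + _ + _]addrC addrA.
have b1 := ritz_bound_invariant hX hY hA hF tau0 XA pl pu pFD pF es et.
have hNA : (- A)^t* = - A by rewrite adjmxN hA.
have hXA := herm_congr X hA; have hYA := herm_congr Y hA.
have es' := eigs_opp hXA es; have et' := eigs_opp hYA et.
rewrite -mulNmx -mulmxN in es'; rewrite -mulNmx -mulmxN in et'.
have pl' : psd (- A - ((- u)%:C)%:M).
  by rewrite scalar_mx_realN opprK addrC; exact: pu.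
have pu' : psd (((- l)%:C)%:M - - A).
  by rewrite scalar_mx_realN opprK addrC; exact: pl.
have XNA : X *m - A = X *m - A *m X^t* *m X by rewrite mulmxN {1}XA !mulNmx.
have b2 := ritz_bound_invariant hX hY hNA hF tau0 XNA pl' pu' pFD pF es' et'.
rewrite opprK [- l + u]addrC in b2.
apply: sum_max_abs_le; [exact: eigs_size es | exact: eigs_size et |].
rewrite -lecR real_complexD (le_trans (lerD b1 b2)) //.
rewrite -mxtraceD -mulmxDr mulmxN mulNmx.
set M := X *m A *m X^t*.
have -> : M - (l%:C)%:M + (- M - ((- u)%:C)%:M) = ((u - l)%:C)%:M.
  by rewrite addrACA subrr add0r scalar_mx_realN opprK addrC scalar_mx_realB.
by rewrite mul_mx_scalar mxtraceZ trF -real_complexM.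
Qed.

End HermitianMatrices.

(** * Orthonormal bases and orthogonal projectors *)

Section InnerProduct.
Variables (R : realType) (k : scalar_kind).
Local Notation K := (scalars R k).
Local Notation C := R[i].
Local Notation "x %:C" := (real_complex R x) (format "x %:C") : ring_scope.
Local Open Scope sesquilinear_scope.

(** Matrices of real spaces are complexified, so that the matrix argument is carried out once, over
    [R[i]]. *)
Definition to_complex : {rmorphism scalars R k -> R[i]} :=
  match k return {rmorphism scalars R k -> R[i]} with
  | RealScalars => (real_complex R : {rmorphism R -> R[i]})
  | ComplexScalars => (idfun : {rmorphism R[i] -> R[i]})
  end.

Lemma to_complex_conj x : to_complex (scalar_conj R k x) = (to_complex x)^*.
Proof. by rewrite /to_complex; move: x; case: k => //= x; exact/esym/conj_real. Qed.

Lemma to_complex_of_real a : to_complex (of_real k a) = a%:C.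
Proof. by rewrite /to_complex; case: k. Qed.

(** The scalar is 1 / sqrt x, which is real because x is positive, hence fixed by conjugation. *)
Lemma exists_normalizer (x : K) : 0 < x ->
  exists2 a : K, a != 0 & a * scalar_conj R k a * x = 1.
Proof.
rewrite /scalar_conj; move: x; case: k => /= x x0.
  have s0 : Num.sqrt x != 0 by rewrite sqrtr_eq0 -ltNge.
  exists (Num.sqrt x)^-1; first by rewrite invr_neq0.
  by rewrite -invfM -expr2 sqr_sqrtr ?ltW // mulVf // gt_eqF.
have s0 : sqrtC x != 0 by rewrite sqrtC_eq0 gt_eqF.
exists (sqrtC x)^-1; first by rewrite invr_neq0.
have -> : (sqrtC x)^-1^* = (sqrtC x)^-1.
  by apply: conj_Creal; rewrite rpredV; apply: ger0_real; rewrite sqrtC_ge0 ltW.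
by rewrite -invfM -expr2 sqrtCK mulVf // gt_eqF.
Qed.

Variables (V : vectType K) (dot : {dot V for scalar_conj R k}).

Lemma dotC u v : dot u v = scalar_conj R k (dot v u).
Proof. by rewrite hermC expr0 mul1r. Qed.

Lemma dot_gt0 u : u != 0 -> 0 < dot u u.
Proof. exact: neq0_dnorm_gt0. Qed.

Definition orthonormal_basis m (Z : {vspace V}) (e : 'I_m -> V) :=
  [/\ \dim Z = m, forall i, e i \in Z & forall i j, dot (e i) (e j) = (i == j)%:R].

(** Gram-Schmidt: normalize a nonzero vector of Z, then recurse in its orthogonal complement within
    Z. *)
Lemma exists_onb m (Z : {vspace V}) : \dim Z = m ->
  exists e : 'I_m -> V, orthonormal_basis Z e.
Proof.
elim: m Z => [|m IH] Z dZ; first by exists (fun _ => 0); split=> // -[].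
have Z0 : Z != 0%VS by rewrite -dimv_eq0 dZ.
have v0 : vpick Z != 0 by rewrite vpick0.
have [a a0 aE] := exists_normalizer (dot_gt0 v0).
pose u := a *: vpick Z.
have uZ : u \in Z by rewrite memvZ // memv_pick.
have uu : dot u u = 1.
  by rewrite /u linearZl_LR /= linearZr_LR /= mulrA.
have dZ' : \dim (Z :&: orthov dot <[u]>) = m.
  rewrite -eq_dim_orthov1 ?dZ //; apply/mem_orthovPn; exists u => //.
  by rewrite -[X in X != 0]/(dot u u) uu oner_eq0.
have [e [_ eZ ee]] := IH _ dZ'.
exists (fun i => if unlift ord0 i is Some j then e j else u); split=> //.
  by move=> i; case: unliftP => [j _|_] //; have := eZ j; rewrite memv_cap => /andP[].
have eu j : dot (e j) u = 0.
  have := eZ j; rewrite memv_cap => /andP[_ /mem_orthovP]; apply.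
  exact: memv_line.
move=> i j /=; case: unliftP => [i' ->|->]; case: unliftP => [j' ->|->] //=.
by rewrite dotC eu rmorph0.
Qed.

Section Basis.
Variables (m : nat) (Z : {vspace V}) (e : 'I_m -> V).
Hypothesis onb : orthonormal_basis Z e.

Lemma dot_onb_sum (c : 'I_m -> K) j : dot (\sum_i c i *: e i) (e j) = c j.
Proof.
have [_ _ ee] := onb.
rewrite linear_sumlz (bigD1 j) //= big1 ?addr0 => [|i ij].
  by rewrite linearZl_LR /= ee eqxx mulr1.
by rewrite linearZl_LR /= ee (negPf ij) mulr0.
Qed.

Lemma onb_expand v : v \in Z -> v = \sum_i dot v (e i) *: e i.
Proof.
have [dZ eZ _] := onb; move=> vZ; pose b := [tuple e i | i < m].
have bE (i : 'I_m) : b`_i = e i by rewrite -tnth_nth tnth_mktuple.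
have bZ : basis_of Z b.
  rewrite basisEfree dZ size_tuple leqnn andbT; apply/andP; split.
    apply/freeP => c c0 i; rewrite -(dot_onb_sum c).
    under eq_bigr do rewrite -bE.
    by rewrite c0 linear0l.
  by apply/span_subvP => _ /mapP[i _ ->].
rewrite {1}(coord_basis bZ vZ); apply: eq_bigr => i _; rewrite bE.
rewrite [in RHS](coord_basis bZ vZ); congr (_ *: _).
by under [in RHS]eq_bigr do rewrite bE; rewrite dot_onb_sum.
Qed.

(** The Fourier sum u lies in Z and v - u is orthogonal to Z. As Z meets its orthogonal trivially,
    the projection fixes u and kills v - u. *)
Lemma orthoprojE v : orthoproj dot Z v = \sum_i dot v (e i) *: e i.
Proof.
have [dZ eZ ee] := onb.
set u := RHS; have uZ : u \in Z by apply: rpred_sum => i _; rewrite memvZ.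
have ZO : (Z :&: orthov dot Z)%VS = 0%VS.
  apply/eqP; rewrite -subv0; apply/subvP => w; rewrite memv_cap memv0.
  case/andP => wZ /mem_orthovP/(_ _ wZ) ww; apply/negPn/negP => /dot_gt0.
  by rewrite ww ltxx.
have wO : v - u \in orthov dot Z.
  apply/mem_orthovP => z zZ; rewrite (onb_expand zZ) linear_sumr big1 // => i _.
  by rewrite linearZr_LR /= linearBl /= dot_onb_sum subrr mulr0.
rewrite /orthoproj -[v in LHS](subrK u) linearD /= (daddv_pi_id ZO uZ).
have := daddv_pi_add ZO (subvP (addvSr _ _) _ wO).
rewrite (daddv_pi_id _ wO) 1?capvC // => /(canRL (addrK _)).
by rewrite subrr => ->; rewrite add0r.
Qed.

Lemma dot_orthoproj v j : dot (orthoproj dot Z v) (e j) = dot v (e j).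
Proof. by rewrite orthoprojE dot_onb_sum. Qed.

End Basis.

(** * Matrices of compressions and their eigenvalues *)

(** The matrices of the identity between the two bases are inverse to each other and conjugate one
    matrix of f into the other. *)
Lemma char_poly_mxof (F : fieldType) (U : vectType F) (f : 'End(U)) m
    (e : m.-tuple U) : basis_of fullv e ->
  char_poly (passmx.mxof (vbasis {:U}) (vbasis {:U}) f) =
  char_poly (\matrix_(i, j < m) coord e j (f e`_i)).
Proof.
move=> eb; have dU : \dim {:U} = m by rewrite (size_basis eb).
move: e eb; rewrite -dU => e eb; set b := vbasis _.
have bb : basis_of {:U} b := vbasisP _.
have -> : \matrix_(i, j < \dim {:U}) coord e j (f e`_i) = passmx.mxof e e f.
  by apply/matrixP => i j; rewrite !mxE /= passmx.vecof_delta.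
have -> : passmx.mxof b b f =
    passmx.mxof b e \1 *m passmx.mxof e e f *m passmx.mxof e b \1.
  by rewrite -!passmx.mxof_comp // comp_lfun1l comp_lfun1r.
apply: char_poly_conj.
by rewrite -passmx.mxof_comp // comp_lfun1l passmx.mxof1 ?(basis_free eb).
Qed.

(** The projector disappears because P_Z v and v have the same products with the e j; [vsproj] is
    only applied to elements of Z. *)
Lemma char_poly_compression m (Z : {vspace V}) (e : 'I_m -> V) (B : 'End(V)) :
  orthonormal_basis Z e ->
  char_poly (passmx.mxof (vbasis {:subvs_of Z}) (vbasis {:subvs_of Z})
    (compression dot Z B)) =
  char_poly (\matrix_(i, j) dot (B (e i)) (e j)).
Proof.
move=> onb; have [dZ eZ _] := onb.
pose b := [tuple vsproj Z (e i) | i < m].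
have bE (i : 'I_m) : b`_i = vsproj Z (e i) by rewrite -tnth_nth tnth_mktuple.
have expd (w : subvs_of Z) : w = \sum_i dot (vsval w) (e i) *: b`_i.
  apply: subvs_inj; rewrite raddf_sum /= {1}(onb_expand onb (subvsP w)).
  by apply: eq_bigr => i _; rewrite bE vsprojK.
have bb : basis_of fullv b.
  rewrite basisEdim size_tuple dimvf /= /dim /= dZ leqnn andbT.
  apply/subvP => w _; rewrite (expd w); apply: rpred_sum => i _.
  by rewrite rpredZ // memv_span // mem_nth // size_tuple.
rewrite (char_poly_mxof _ bb); congr char_poly; apply/matrixP => i j; rewrite !mxE.
rewrite bE [X in coord _ _ X]expd (coord_sum_free _ _ (basis_free bb)).
rewrite /compression /restriction !comp_lfunE !lfunE /= !vsprojK //.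
  exact: dot_orthoproj.
exact: memv_pi.
Qed.

(** If w is an orthonormal basis of a space containing the e i, row i holds the coordinates of e i.
    For orthonormal e, [gram_mx (A \o e) e] represents the compression of A to the span of e. *)
Definition gram_mx m n (e : 'I_m -> V) (w : 'I_n -> V) : 'M[C]_(m, n) :=
  \matrix_(i, j) to_complex (dot (e i) (w j)).

Lemma gram_mx_adj m n (e : 'I_m -> V) (w : 'I_n -> V) :
  (gram_mx e w)^t* = gram_mx w e.
Proof.
by apply/matrixP => i j; rewrite !mxE -to_complex_conj -dotC.
Qed.

(** Parseval: f i is expanded in the basis e. *)
Lemma gram_mxM m n p (Z : {vspace V}) (f : 'I_m -> V) (e : 'I_n -> V)
    (A : 'End(V)) (g : 'I_p -> V) :
  orthonormal_basis Z e -> (forall i, f i \in Z) ->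
  gram_mx f e *m gram_mx (A \o e) g = gram_mx (A \o f) g.
Proof.
move=> onb fZ; apply/matrixP => i j; rewrite !mxE /=.
rewrite [in RHS](onb_expand onb (fZ i)) linear_sum linear_sumlz rmorph_sum /=.
by apply: eq_bigr => l _; rewrite !mxE linearZ linearZl_LR rmorphM.
Qed.

Lemma gram_mxMl m n p (Z : {vspace V}) (f : 'I_m -> V) (e : 'I_n -> V)
    (g : 'I_p -> V) :
  orthonormal_basis Z e -> (forall i, f i \in Z) ->
  gram_mx f e *m gram_mx e g = gram_mx f g.
Proof.
move=> onb fZ; have := gram_mxM \1%VF g onb fZ.
have id_o q (h : 'I_q -> V) : gram_mx (\1%VF \o h) g = gram_mx h g.
  by apply/matrixP => i j; rewrite !mxE /= lfunE.
by rewrite !id_o.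
Qed.

Lemma gram_mxMr m n p (Z : {vspace V}) (f : 'I_m -> V) (e : 'I_n -> V)
    (g : 'I_p -> V) :
  orthonormal_basis Z e -> (forall i, f i \in Z) ->
  gram_mx g e *m gram_mx e f = gram_mx g f.
Proof.
move=> onb fZ; rewrite -[LHS]adjmxK adjmxM !gram_mx_adj (gram_mxMl _ onb fZ).
by rewrite gram_mx_adj.
Qed.

Lemma gram_mx_onb m (Z : {vspace V}) (e : 'I_m -> V) :
  orthonormal_basis Z e -> gram_mx e e = 1%:M.
Proof. by case=> _ _ ee; apply/matrixP => i j; rewrite !mxE ee rmorph_nat. Qed.

Lemma gram_mx_herm m (e : 'I_m -> V) (A : 'End(V)) :
  hermitian_op dot A -> (gram_mx (A \o e) e)^t* = gram_mx (A \o e) e.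
Proof. by move=> hA; rewrite gram_mx_adj; apply/matrixP => i j; rewrite !mxE /= hA. Qed.

Lemma gram_mx_orthoproj m n (Z : {vspace V}) (e : 'I_m -> V) (f : 'I_n -> V) :
  orthonormal_basis Z f ->
  gram_mx (orthoproj dot Z \o e) e = gram_mx e f *m gram_mx f e.
Proof.
move=> onb; apply/matrixP => i j; rewrite !mxE /= (orthoprojE onb).
rewrite linear_sumlz rmorph_sum; apply: eq_bigr => l _.
by rewrite !mxE linearZl_LR rmorphM.
Qed.

(** Complexification is injective on polynomials, so a factorization with real roots can be read
    over either field. *)
Lemma is_eigenvalue_vectorP m (Z : {vspace V}) (e : 'I_m -> V) (B : 'End(V)) s :
  orthonormal_basis Z e ->
  is_eigenvalue_vector (compression dot Z B) s <-> eigs (gram_mx (B \o e) e) s.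
Proof.
move=> onb; rewrite /is_eigenvalue_vector /eigs (char_poly_compression B onb).
set M := \matrix_(i, j) _.
have -> : gram_mx (B \o e) e = map_mx to_complex M.
  by apply/matrixP => i j; rewrite !mxE.
rewrite -map_char_poly.
have -> : \prod_(a <- s) ('X - (a%:C)%:P) =
    map_poly to_complex (\prod_(a <- s) ('X - (of_real k a)%:P)).
  rewrite rmorph_prod; apply: eq_bigr => a _.
  by rewrite rmorphB /= map_polyX map_polyC /= to_complex_of_real.
split=> -[ss sE]; split=> //; first by rewrite sE.
exact: (map_poly_inj to_complex).
Qed.

(** The spectral theorem supplies an eigenvalue vector, so [xget] does not return its default. *)
Lemma eigs_Lambda m (Z : {vspace V}) (e : 'I_m -> V) (B : 'End(V)) :
  orthonormal_basis Z e -> (gram_mx (B \o e) e)^t* = gram_mx (B \o e) e ->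
  eigs (gram_mx (B \o e) e) (Lambda (compression dot Z B)).
Proof.
move=> onb /eigs_exists[s es]; apply/(is_eigenvalue_vectorP B _ onb).
by apply: (@xgetPex _ [::] [set s | is_eigenvalue_vector _ s]%classic); exists s;
  apply/(is_eigenvalue_vectorP B _ onb).
Qed.

(** * Extreme eigenvalues and passage to weak majorization *)

Lemma psd_eigs_bounds n (M : 'M[C]_n) s : M^t* = M -> eigs M s ->
  psd (M - ((last 0 s)%:C)%:M) /\ psd (((head 0 s)%:C)%:M - M).
Proof.
move=> hM es; have [U hU ->] := eigs_udiag hM es.
have [ss _] := es; have sn := eigs_size es.
rewrite !(udiag_cst hU) !udiagB; split; apply/(psd_udiag hU) => i.
  rewrite subr_ge0 -nth_last; apply: (sorted_leq_nth ge_trans ge_refl) => //.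
  - by rewrite inE sn.
  - by rewrite inE sn; case: (n) i => // - [].
  - by rewrite sn; case: (n) i => [[]|n' i] //=; rewrite -ltnS.
by rewrite subr_ge0 nonincr_head // sn.
Qed.

Lemma sorted_last_le_head (s : seq R) : sorted >=%R s -> last 0 s <= head 0 s.
Proof.
case: s => [|a s] // ss; by rewrite -nth_last; apply: nonincr_head.
Qed.

(* The sum of the k largest entries of z is the minimum over c of
   k c + sum_i max(z_i - c, 0), attained at the k-th largest entry. *)
Lemma weakly_majorized_pos_part m (s t c : seq R) (d : R) :
  size s = m -> size t = m -> size c = m ->
  0 <= d -> sorted >=%R c -> all (>= 0) c ->
  (forall tau, 0 <= tau -> \sum_(i < m) Num.max (`|s`_i - t`_i| - tau * d) 0
     <= d * \sum_(a <- c) Num.max (a - tau) 0) ->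
  abs_diff s t ≺w [seq d * a | a <- c].
Proof.
move=> sm tm cm d0 sc c0 H.
have zm : size (abs_diff s t) = m by rewrite size_map size_zip sm tm minnn.
split=> [|j]; first by rewrite zm size_map cm.
rewrite zm => /andP[j0 jm].
have -> : sort >=%R [seq d * a | a <- c] = [seq d * a | a <- c].
  apply: (sorted_sort ge_trans); rewrite sorted_map; apply: sub_sorted sc => x y /= xy.
  exact: ler_wpM2l.
(* Entries are indexed from 0, so this is the j-th largest one. *)
pose tau := c`_j.-1; have tau0 : 0 <= tau.
  by move/(all_nthP 0): c0; apply; rewrite cm prednK.
apply: (le_trans (sum_take_le_pos (tau * d) _)); first by rewrite size_sort zm.
rewrite (perm_big _ (permEl (perm_sort _ _))) /=.
rewrite [X in _ + X](big_nth 0) zm big_mkord.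
have -> : \sum_(i < m) Num.max ((abs_diff s t)`_i - tau * d) 0 =
    \sum_(i < m) Num.max (`|s`_i - t`_i| - tau * d) 0.
  apply: eq_bigr => i _; rewrite /abs_diff (nth_map (0, 0)) ?size_zip ?sm ?tm ?minnn //.
  by rewrite nth_zip ?sm.
apply: (le_trans (lerD (lexx _) (H tau tau0))).
rewrite -map_take big_map -mulr_sumr mulrC -mulrnAr -mulrDr ler_wpM2l //.
(* The first j entries are at least tau and the others at most tau, so j tau plus all excesses is
   exactly the sum of the first j. *)
rewrite -[X in _ + \sum_(a <- X) _](cat_take_drop j) big_cat /= addrA.
rewrite (sum_pos_part_le0 (s := drop j c)); last first.
  apply/(all_nthP 0) => i; rewrite size_drop cm nth_drop => ij.
  apply: (sorted_leq_nth ge_trans ge_refl) => //; rewrite ?inE ?cm ?prednK //.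
    by rewrite -ltn_subRL.
  by rewrite (leq_trans (leq_pred j)) // leq_addr.
have sj : size (take j c) = j by rewrite size_takel ?cm.
rewrite addr0 -[X in _ *+ X]sj sum_pos_part_ge0 //; apply/(all_nthP 0) => i.
rewrite sj => ij; rewrite nth_take //.
apply: (sorted_leq_nth ge_trans ge_refl) => //; rewrite ?inE ?cm ?prednK //.
  exact: leq_trans ij jm.
by rewrite -ltnS prednK.
Qed.

(** * Subspaces in the coordinates of a larger space *)

Lemma gram_mx_unitary m n (Z W : {vspace V}) (e : 'I_m -> V) (w : 'I_n -> V) :
  orthonormal_basis Z e -> orthonormal_basis W w -> (Z <= W)%VS ->
  gram_mx e w \is unitarymx.
Proof.
move=> onbe onbw /subvP ZW; apply/unitarymxP.
have [_ eZ _] := onbe.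
rewrite gram_mx_adj (gram_mxMl e onbw) ?(gram_mx_onb onbe) // => i; exact: ZW.
Qed.

Lemma gram_mx_compression m n (Z W : {vspace V}) (z : 'I_m -> V) (w : 'I_n -> V)
    (A : 'End(V)) :
  orthonormal_basis Z z -> orthonormal_basis W w -> (Z <= W)%VS ->
  gram_mx z w *m gram_mx (A \o w) w *m (gram_mx z w)^t* = gram_mx (A \o z) z.
Proof.
move=> [_ zZ _] onbw /subvP ZW; have zW i : z i \in W by apply: ZW.
by rewrite gram_mx_adj (gram_mxM A w onbw zW) (gram_mxMr _ onbw zW).
Qed.

(** A maps each z i into Z, so expanding the image in the basis z loses nothing. *)
Lemma gram_mx_invariant m n (Z W : {vspace V}) (z : 'I_m -> V) (w : 'I_n -> V)
    (A : 'End(V)) :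
  orthonormal_basis Z z -> orthonormal_basis W w -> (Z <= W)%VS ->
  invariant_under A Z ->
  gram_mx z w *m gram_mx (A \o w) w =
  gram_mx z w *m gram_mx (A \o w) w *m (gram_mx z w)^t* *m gram_mx z w.
Proof.
move=> onbz onbw ZW invZ; have [_ zZ _] := onbz.
rewrite (gram_mx_compression _ onbz onbw ZW).
rewrite (gram_mxM A w onbw) => [|i]; last exact: (subvP ZW).
rewrite (gram_mxMl w onbz) // => i; apply: (subvP invZ).
exact: memv_img.
Qed.

(** * Principal angles *)

Lemma acos_antitone (x y : R) : -1 <= x <= 1 -> -1 <= y <= 1 -> x <= y ->
  acos y <= acos x.
Proof.
move=> hx hy xy; rewrite leNgt -ltr_cos ?in_itv /= ?acos_ge0 ?acos_lepi //.
by rewrite !acosK ?in_itv // -leNgt.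
Qed.

Lemma Theta_principal_angles m (X Y : {vspace V}) (e f : 'I_m -> V) :
  orthonormal_basis X e -> orthonormal_basis Y f ->
  is_principal_angles dot X Y (Theta dot X Y).
Proof.
move=> eX fY; apply: (@xgetPex _ [::] [set t | is_principal_angles dot X Y t]%classic).
pose N := gram_mx (orthoproj dot Y \o e) e.
have NE : N = gram_mx e f *m (gram_mx e f)^t*.
  by rewrite gram_mx_adj; apply: gram_mx_orthoproj.
have hN : N^t* = N by rewrite NE gram_herm.
have es : eigs N (Lambda (compression dot X (orthoproj dot Y))).
  exact: eigs_Lambda.
set c := Lambda _ in es *; have [sc _] := es.
have [U hU NU] := eigs_udiag hN es.
have c01 : {in c, forall a, 0 <= a <= 1}.
  apply/allP/(all_nthP 0) => i; rewrite (eigs_size es) => im.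
  rewrite (eigs_ge0 hN _ es) /=; last by rewrite NE; apply: psd_gram.
  (* In coordinates of X + Y, both families become matrices with orthonormal rows, and
     [psd_one_sub_gram] gives the upper bound 1. *)
  have [w onbw] := exists_onb (erefl (\dim (X + Y))).
  have : psd (1%:M - N).
    rewrite NE; have [_ eXY _] := eX.
    have eW i' : e i' \in (X + Y)%VS by apply: subvP (addvSl _ _) _ (eXY i').
    have <- : gram_mx e w *m (gram_mx f w)^t* = gram_mx e f.
      by rewrite gram_mx_adj (gram_mxMl _ onbw).
    apply: psd_one_sub_gram.
      exact: gram_mx_unitary eX onbw (addvSl _ _).
    exact: gram_mx_unitary fY onbw (addvSr _ _).
  rewrite NU -(rmorph1 (real_complex R)) (udiag_cst hU) udiagB.
  by move=> /(psd_udiag hU)/(_ (Ordinal im)); rewrite subr_ge0.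
(* The smallest squared cosine gives the largest angle, hence the reversal. *)
exists [seq acos (Num.sqrt a) | a <- rev c].
have sq a : a \in c -> 0 <= Num.sqrt a /\ -1 <= Num.sqrt a <= 1.
  move=> /c01 /andP[a0 a1].
  have s1 : Num.sqrt a <= 1 by rewrite -[X in _ <= X]sqrtr1 ler_wsqrtr.
  by split; rewrite ?sqrtr_ge0 // s1 andbT (le_trans _ (sqrtr_ge0 a)) // lerN10.
split.
- rewrite map_rev rev_sorted sorted_map.
  apply: (sub_in_sorted (P := mem c)) sc; last exact/allP.
  move=> x y /= /sq[x0 x1] /sq[y0 y1] xy.
  by apply: acos_antitone => //; apply: ler_wsqrtr.
- move=> x /mapP[a]; rewrite mem_rev => /sq[a0 a1] ->.
  rewrite acos_ge0 //= -acos0; apply: acos_antitone => //.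
  by rewrite lerN10 ler01.
- rewrite -map_comp -[RHS]map_id; apply/eq_in_map => a; rewrite mem_rev => ac /=.
  have [a0 a1] := sq _ ac; rewrite acosK ?in_itv // sqr_sqrtr //.
  by have /andP[] := c01 _ ac.
Qed.

Lemma char_poly_sin2 m (X Y : {vspace V}) (e f : 'I_m -> V) :
  orthonormal_basis X e -> orthonormal_basis Y f ->
  char_poly (1%:M - gram_mx e f *m (gram_mx e f)^t*) =
  \prod_(t <- Theta dot X Y) ('X - ((sin t ^+ 2)%:C)%:P).
Proof.
move=> eX fY; have [_ _ tE] := Theta_principal_angles eX fY.
have NE : gram_mx (orthoproj dot Y \o e) e = gram_mx e f *m (gram_mx e f)^t*.
  by rewrite gram_mx_adj (gram_mx_orthoproj e fY).
have hN : (gram_mx (orthoproj dot Y \o e) e)^t* = gram_mx (orthoproj dot Y \o e) e.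
  by rewrite NE gram_herm.
have [_ cN] := eigs_Lambda eX hN.
have := char_poly_affine (-1) 1 hN cN.
rewrite real_complexN rmorph1 scaleN1r addrC NE => ->.
rewrite -(perm_big _ (permEl (perm_rev _))) -tE big_map.
apply: eq_bigr => t _.
by have -> : -1 * cos t ^+ 2 + 1 = sin t ^+ 2 by rewrite sin2cos2 mulN1r addrC.
Qed.

End InnerProduct.

(** * Assembly in an orthonormal basis of X + Y *)

Theorem theorem2p1 (R : realType) (k : scalar_kind) (H : vectType (scalars R k))
    (dot : {dot H for scalar_conj R k}) (A : 'End(H)) (X Y : {vspace H}) :
  hermitian_op dot A ->
  \dim X = \dim Y ->
  let LX := Lambda (compression dot X A) in
  let LY := Lambda (compression dot Y A) in
  let lmax := lambda_max (compression dot (X + Y)%VS A) in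
  let lmin := lambda_min (compression dot (X + Y)%VS A) in
  (abs_diff LX LY ≺w [seq (lmax - lmin) * sin t | t <- Theta dot X Y]) /\
  (invariant_under A X \/ invariant_under A Y ->
   abs_diff LX LY ≺w [seq (lmax - lmin) * sin t ^+ 2 | t <- Theta dot X Y]).
Proof.
move=> hA dXY LX LY lmax lmin.
have [e eX] := exists_onb dot dXY.
have [f fY] := exists_onb dot (erefl (\dim Y)).
have [w wW] := exists_onb dot (erefl (\dim (X + Y))).
have uX := gram_mx_unitary eX wW (addvSl X Y).
have uY := gram_mx_unitary fY wW (addvSr X Y).
have eigsL Z m (z : 'I_m -> H) : orthonormal_basis dot Z z ->
    eigs (gram_mx dot (A \o z) z) (Lambda (compression dot Z A)).
  by move=> onbz; apply: eigs_Lambda => //; apply: gram_mx_herm.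
have hAw := gram_mx_herm w hA.
(* In the basis w of X + Y, the bounds l and u are [lmin] and [lmax]. *)
have [pl pu] := psd_eigs_bounds hAw (eigsL _ _ _ wW).
have es := eigsL _ _ _ eX; have et := eigsL _ _ _ fY.
have XfE : gram_mx dot e w *m (map_mx Num.conj (gram_mx dot f w)^T) = gram_mx dot e f.
  have [_ eZ _] := eX; rewrite gram_mx_adj (gram_mxMl f wW) // => i.
  by apply: subvP (addvSl X Y) _ (eZ i).
have [st t01 tE] := Theta_principal_angles eX fY.
set th := Theta dot X Y in st t01 tE *.
have cK := char_poly_sin2 eX fY.
have sX := eigs_size es; have sY := eigs_size et.
(* The number of angles is read off the degree of the characteristic polynomial. *)
have sth : size th = \dim Y.
  have := congr1 (fun p : {poly _} => size p) cK.
  by rewrite size_char_poly size_prod_XsubC => -[].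
have d0 : 0 <= lmax - lmin.
  by rewrite subr_ge0; apply: sorted_last_le_head; exact: (proj1 (eigsL _ _ _ wW)).
have sin0 : {in th, forall t, 0 <= sin t}.
  move=> t /t01 /andP[t0 t1]; apply: sin_ge0_pi; rewrite t0 (le_trans t1) //.
  by rewrite ler_pdivrMr // ler_peMr ?pi_ge0 // ler1n.
have ss : sorted >=%R [seq sin t | t <- th].
  rewrite sorted_map; apply: (sub_in_sorted (P := mem th)) st; last exact/allP.
  move=> x y /t01/andP[x0 x1] /t01/andP[y0 y1] /= xy.
  have hp : - (pi / 2) <= 0 :> R by rewrite oppr_le0 divr_ge0 ?pi_ge0.
  by rewrite leNgt ltr_sin ?in_itv /= ?x1 ?y1 ?andbT ?(le_trans hp) // -leNgt.
have s0 : all (>= 0) [seq sin t | t <- th] by apply/allP => _ /mapP[t /sin0 t0 ->].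
have cK1 : char_poly (1%:M - gram_mx dot e f *m map_mx Num.conj (gram_mx dot e f)^T) =
    \prod_(a <- [seq sin t | t <- th]) ('X - (real_complex R (a ^+ 2))%:P).
  by rewrite big_map.
have ss2 : sorted >=%R [seq sin t ^+ 2 | t <- th].
  rewrite (map_comp (fun a => a ^+ 2)) sorted_map.
  apply: (sub_in_sorted (P := mem [seq sin t | t <- th])) ss; last exact/allP.
  move=> x y /(allP s0) x0 /(allP s0) y0 /= xy.
  by rewrite lerXn2r.
have s20 : all (>= 0) [seq sin t ^+ 2 | t <- th].
  by apply/allP => _ /mapP[t _ ->]; rewrite sqr_ge0.
rewrite -(gram_mx_compression A eX wW (addvSl X Y)) in es.
rewrite -(gram_mx_compression A fY wW (addvSr X Y)) in et.
split=> [|inv].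
  rewrite (map_comp (fun a => (lmax - lmin) * a)).
  apply: (weakly_majorized_pos_part sX sY) => // [|tau tau0]; first by rewrite size_map.
  by apply: (ritz_change uX uY hAw tau0 pl pu es et s0); rewrite XfE.
rewrite (map_comp (fun a => (lmax - lmin) * a)).
apply: (weakly_majorized_pos_part sX sY) => // [|tau tau0]; first by rewrite size_map.
case: inv => inv.
  have XA := gram_mx_invariant eX wW (addvSl X Y) inv.
  apply: (ritz_change_invariant uX uY hAw tau0 XA pl pu es et).
  by rewrite XfE cK big_map.
(* If Y is the invariant subspace, X and Y are exchanged: the absolute differences are symmetric,
   and 1 - K^* K has the characteristic polynomial of 1 - K K^*. *)
have YA := gram_mx_invariant fY wW (addvSr X Y) inv.
under eq_bigr do rewrite distrC.
apply: (ritz_change_invariant uY uX hAw tau0 YA pl pu et es).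
have <- : map_mx Num.conj (gram_mx dot e f)^T =
    gram_mx dot f w *m (map_mx Num.conj (gram_mx dot e w)^T).
  by rewrite -XfE adjmxM adjmxK.
by rewrite adjmxK -char_poly_one_sub_mulmxC cK big_map.
Qed.
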